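(* Let $\eta=\{\boldsymbol{\eta}^{(1)}=(\eta_1^1,\dots,\eta_n^1),\dots,\boldsymbol{\eta}^{(k)}=(\eta_1^k,\dots,\eta_n^k)\}\subseteq\mathbb{N}^n$ be a finite set of vectors such that: (i) $\gcd\{\eta_i^h : h=1,\dots,k\}=1$ for every $i=1,\dots,n$; (ii) for all $i,j\in\{1,\dots,n\}$ with $i\ne j$ there exists $l\in\{1,\dots,k\}$ such that $\eta_i^l\neq\eta_j^l$. Then the set $S_\eta$ of all good semigroups of $\mathbb{N}^n$ that contain $\eta$ and are minimal with respect to set inclusion (among good semigroups containing $\eta$) is finite.
   Context: $\mathbb{N}=\{0,1,2,\dots\}$. A submonoid $S$ of $(\mathbb{N}^n,+)$ is a good semigroup if: (G1) $\boldsymbol{\alpha},\boldsymbol{\beta}\in S$ implies that the componentwise minimum $\min(\boldsymbol{\alpha},\boldsymbol{\beta})$ is in $S$; (G2) there is $\boldsymbol{\delta}\in\mathbb{N}^n$ with $\boldsymbol{\delta}+\mathbb{N}^n\subseteq S$; (G3) if $\boldsymbol{\alpha},\boldsymbol{\beta}\in S$, $\boldsymbol{\alpha}\ne\boldsymbol{\beta}$ and $\alpha_i=\beta_i$ for some $i$, then there is $\boldsymbol{\epsilon}\in S$ with $\epsilon_i>\alpha_i=\beta_i$ and $\epsilon_j\ge\min\{\alpha_j,\beta_j\}$ for each $j\neq i$, with equality for those $j$ with $\alpha_j\ne\beta_j$. Good semigroups are always assumed local: if $\boldsymbol{\alpha}\in S$ has some zero coordinate, then $\boldsymbol{\alpha}=\boldsymbol{0}$.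 *)

(* Defs.v *)
From mathcomp Require Import all_boot all_order all_algebra.
From mathcomp Require Import boolp classical_sets cardinality.

Set Implicit Arguments.
Unset Strict Implicit.
Unset Printing Implicit Defensive.

Import GRing.Theory.

Local Open Scope classical_set_scope.

(* The additive structure on [{ffun 'I_n -> nat}] (notations [0%R] and
   [(a + b)%R]) is MathComp's pointwise one. *)
Notation natvec n := {ffun 'I_n -> nat}.

Section GoodSemigroups.
Context {n : nat}.
Implicit Types (a b d e : natvec n) (S T : set (natvec n)).

Definition min_vec a b : natvec n := [ffun i => minn (a i) (b i)].

Definition submonoid S : Prop :=
  S 0%R /\ (forall a b, S a -> S b -> S (a + b)%R).

Definition min_closed S : Prop :=
  forall a b, S a -> S b -> S (min_vec a b).

Definition has_conductor S : Prop :=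
  exists d, forall a, S (d + a)%R.

Definition exchange S : Prop :=
  forall a b (i : 'I_n), S a -> S b -> a <> b -> a i = b i ->
  exists e, [/\ S e, a i < e i &
    forall j, j != i ->
      minn (a j) (b j) <= e j /\ (a j <> b j -> e j = minn (a j) (b j))].

Definition local S : Prop :=
  forall a, S a -> (exists i, a i = 0) -> a = 0%R.

(* Good semigroups are local by convention, so minimality below is among local
   good semigroups. *)
Definition good_semigroup S : Prop :=
  [/\ submonoid S, min_closed S, has_conductor S, exchange S & local S].

Definition minimal_good_semigroups (A : set (natvec n)) : set (set (natvec n)) :=
  [set S | [/\ good_semigroup S, A `<=` S &
    forall T, good_semigroup T -> A `<=` T -> T `<=` S -> T = S]].

End GoodSemigroups.

(* Main.v *)
(* All good semigroups containing [eta] contain one common orthant [c + N^n];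
   such a semigroup is determined by its trace on the box [[0, c]^n], so there
   are only finitely many of them, minimal or not.

   For the orthant, by (G1) it is enough to find, for each coordinate [i] and
   each large [a], elements with [i]-th coordinate [a] and all others
   arbitrarily large; adding elements reduces this to one other coordinate [j]
   at a time.  By (i) and (ii) two vectors [u], [v] of [eta] have different
   slopes [u_j / u_i < v_j / v_i].  In the monoid generated by [eta], each large
   [a] occurs as [i]-th coordinate along the direction [v], and each large [b]
   as [j]-th coordinate along [u].  So an element [(a, b)] above the direction
   of [v] shares its [j]-th coordinate with some [(x, b)], [x > a], and (G3)
   gives [(a, b')] with [b' > b], to which the same argument applies. *)
Require Import Defs.
From mathcomp Require Import all_boot all_order all_algebra.
From mathcomp Require Import boolp classical_sets cardinality.
From mathcomp Require Import zify.

Local Open Scope classical_set_scope.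

(** * Elements of a submonoid with a prescribed coordinate *)

Lemma natvecD {n} (a b : natvec n) i : (a + b)%R i = a i + b i.
Proof. by rewrite ffunE. Qed.

Lemma natvecMn {n} (a : natvec n) q i : (a *+ q)%R i = q * a i.
Proof.
elim: q => [|q IHq]; first by rewrite GRing.mulr0n ffunE.
by rewrite GRing.mulrS natvecD IHq mulSn.
Qed.

Lemma submonoid_mulrn {n} (M : set (natvec n)) : submonoid M ->
  forall a q, M a -> M (a *+ q)%R.
Proof.
move=> [M0 MD] a q Ma; elim: q => [|q IHq]; first by rewrite GRing.mulr0n.
by rewrite GRing.mulrS; apply: MD.
Qed.

(** Bézout's identity, one generator at a time; modulo [m], nonnegative coefficients suffice. *)
Lemma submonoid_residue {n k : nat} (M : set (natvec n)) (eta : 'I_k -> natvec n)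
    (i : 'I_n) m : submonoid M -> range eta `<=` M -> 0 < m ->
  exists2 w, M w & w i = \big[gcdn/0]_(h < k) eta h i %[mod m].
Proof.
move=> monM etaM m_gt0; have [M0 MD] := monM.
elim/big_ind: _ => [|x y|h _].
- by exists 0%R => //; rewrite ffunE.
- move=> [w Mw wx] [w' Mw' wy].
  have [->|x_gt0] := posnP x; first by exists w' => //; rewrite gcd0n.
  have [a _ /dvdnP[p gcdE]] := Bezoutl y x_gt0.
  (* [gcdn x y = p x - a y], where [- a] is replaced by [a (m - 1)]. *)
  exists (w *+ p + w' *+ (a * m.-1))%R.
    by apply: MD; apply: submonoid_mulrn.
  rewrite natvecD !natvecMn -modnDm -[(p * _) %% m]modnMmr wx.
  rewrite -[(_ * w' i) %% m]modnMmr wy modnMmr modnMmr modnDm -gcdE.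
  have -> : gcdn x y + a * y + a * m.-1 * y = a * y * m + gcdn x y by nia.
  by rewrite modnMDl.
- by exists (eta h) => //; apply: etaM; exists h.
Qed.

(** Copies of some [w] with [w i] congruent to 1 modulo [u i] correct the residue of [a]; copies of
    [u] supply the rest. *)
Lemma submonoid_along {n k : nat} (M : set (natvec n)) (eta : 'I_k -> natvec n)
    (i : 'I_n) (u : natvec n) : submonoid M -> range eta `<=` M ->
  \big[gcdn/0]_(h < k) eta h i = 1 -> M u -> 0 < u i ->
  exists c, forall a, c <= a -> exists e, [/\ M e, e i = a &
    forall j, (a - c) * u j <= e j * u i].
Proof.
move=> monM etaM gcd1 Mu u_gt0; have [M0 MD] := monM.
have [w Mw wi1] := submonoid_residue M eta i (u i) monM etaM u_gt0.
(* This bounds [r * w i] for every residue [r < u i]. *)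
exists (u i * w i) => a le_c_a.
set r := a %% u i; have lt_r : r < u i by rewrite ltn_mod.
have le_r : r * w i <= u i * w i by rewrite leq_mul2r (ltnW lt_r) orbT.
have /dvdnP[q aE] : u i %| a - r * w i.
  rewrite -eqn_mod_dvd; last exact: leq_trans le_r _.
  by rewrite -[(r * _) %% _]modnMmr wi1 gcd1 modnMmr muln1 modn_mod.
exists (w *+ r + u *+ q)%R; split.
- by apply: MD; apply: submonoid_mulrn.
- by rewrite natvecD !natvecMn -aE subnKC // (leq_trans le_r).
move=> j; rewrite natvecD !natvecMn.
have le_q : a - u i * w i <= q * u i by rewrite -aE leq_sub2l.
apply: (@leq_trans (q * u i * u j)); first by rewrite leq_mul2r le_q orbT.
by rewrite mulnDl mulnAC leq_addl.
Qed.

(** If all slopes agree, then [x l * y h = y l * x h] for all [h], and the gcd over [h] gives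
    [x l = y l]. *)
Lemma exists_slope_lt {k : nat} (x y : 'I_k -> nat) :
  \big[gcdn/0]_(h < k) x h = 1 -> \big[gcdn/0]_(h < k) y h = 1 ->
  (exists l, x l <> y l) -> exists h h', y h * x h' < y h' * x h.
Proof.
move=> gcdx gcdy [l neq_l]; apply: contrapT => no_lt; apply: neq_l.
have cross h h' : y h' * x h = y h * x h'.
  apply/eqP; rewrite eqn_leq; apply/andP.
  by split; rewrite leqNgt; apply/negP => lt; apply: no_lt; eauto.
have big_mull d (z : 'I_k -> nat) :
    d * \big[gcdn/0]_(h < k) z h = \big[gcdn/0]_(h < k) (d * z h).
  exact: (big_morph (muln d) (muln_gcdr d) (muln0 d)).
rewrite -[LHS]muln1 -[RHS]muln1 -{1}gcdy -gcdx !big_mull.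
by apply: eq_bigr => h _; rewrite mulnC cross.
Qed.

Definition good_over {n k : nat} (eta : 'I_k -> natvec n) (S : set (natvec n)) :=
  good_semigroup S /\ range eta `<=` S.

(** * A conductor common to all good semigroups containing [eta] *)

Section CommonConductor.
Context {n k : nat} (eta : 'I_k -> natvec n).
Hypothesis eta_gcd : forall i : 'I_n, \big[gcdn/0]_(h < k) eta h i = 1.
Hypothesis eta_sep : forall i j : 'I_n, i <> j -> exists l, eta l i <> eta l j.
Hypothesis eta_local : forall h i j, 0 < eta h i -> 0 < eta h j.

(* Working in this intersection makes the bounds below independent of the
   good semigroup. *)
Let M : set (natvec n) := [set a | forall S, good_over eta S -> S a].

Let monM : submonoid M.
Proof.
split=> [S [[[S0 _] _ _ _ _] _] //|a b Ma Mb S SP].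
by have [[[_ SD] _ _ _ _] _] := SP; apply: SD; [apply: Ma | apply: Mb].
Qed.

Let etaM : range eta `<=` M.
Proof. by move=> a eta_a S [_]; apply. Qed.

Lemma eta_gt0 i : exists h, 0 < eta h i.
Proof.
apply: contrapT => no_pos.
have := eta_gcd i; rewrite big1 // => h _.
by apply/eqP; rewrite -leqn0 leqNgt; apply/negP => ?; apply: no_pos; exists h.
Qed.

Lemma good_over_coord i : exists c, forall S, good_over eta S ->
  forall a, c <= a -> exists2 e, S e & e i = a.
Proof.
have [h h_gt0] := eta_gt0 i.
have Mh : M (eta h) by apply: etaM; exists h.
have [c cP] := submonoid_along M eta i _ monM etaM (eta_gcd i) Mh h_gt0.
by exists c => S SP a /cP[e [Me ei _]]; exists e => //; apply: Me.
Qed.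

Lemma good_over_coord2 i j : i <> j -> exists c, forall S, good_over eta S ->
  forall a K, c <= a -> exists e, [/\ S e, e i = a & K <= e j].
Proof.
move=> neq_ij.
have [h [h' lt_slope]] :=
  exists_slope_lt (eta^~ i) (eta^~ j) (eta_gcd i) (eta_gcd j) (eta_sep i j neq_ij).
set u := eta h in lt_slope; set v := eta h' in lt_slope.
have ui_gt0 : 0 < u i by move: lt_slope; case: (u i) => //; rewrite muln0.
have vj_gt0 : 0 < v j by move: lt_slope; case: (v j).
have uj_gt0 : 0 < u j by apply: eta_local ui_gt0.
have vi_gt0 : 0 < v i by apply: eta_local vj_gt0.
have Mu : M u by apply: etaM; exists h.
have Mv : M v by apply: etaM; exists h'.
have [cv cvP] := submonoid_along M eta i v monM etaM (eta_gcd i) Mv vi_gt0.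
have [cu cuP] := submonoid_along M eta j u monM etaM (eta_gcd j) Mu uj_gt0.
(* The term [cv] provides [e0], and [cu * v i] ensures [cu <= e j]. The last two products absorb the
   errors due to [cv] and [cu] in the proof of [a < f i], where the slope inequality gains [a]. *)
exists (cv + cu * v i + cv * v j * u i + cu * v i * u i + 1) => S SP a K le_a.
have /cvP[e0 [Me0 e0i /(_ j) e0j]] : cv <= a by lia.
have [[_ _ _ exS _] _] := SP.
have above e : S e -> e i = a -> e0 j <= e j ->
    exists e', [/\ S e', e' i = a & e j < e' j].
  move=> Se ei le_e.
  have le_b : (a - cv) * v j <= e j * v i.
    by apply: leq_trans e0j _; rewrite leq_mul2r le_e orbT.
  have /cuP[f [Mf fj /(_ i) fi]] : cu <= e j.
    rewrite -(leq_pmul2r vi_gt0); apply: leq_trans le_b.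
    by apply: leq_trans (leq_pmulr _ vj_gt0); lia.
  have lt_a : a < f i.
    rewrite -(ltn_pmul2r uj_gt0) -(ltn_pmul2r vi_gt0).
    have le1 : (e j - cu) * u i * v i <= f i * u j * v i.
      by rewrite leq_mul2r fi orbT.
    have le2 : (a - cv) * v j * u i <= e j * v i * u i.
      by rewrite leq_mul2r le_b orbT.
    have le3 : a + a * (u j * v i) <= a * (v j * u i).
      by rewrite -mulnS leq_mul2l lt_slope orbT.
    rewrite !mulnBl in le1 le2; nia.
  have neq_ef : e <> f by move=> ef; move: lt_a; rewrite -ef ei ltnn.
  (* As [e i < f i], (G3) at [j] keeps the [i]-th coordinate equal to [a]. *)
  have [e' [Se' lt_e' /(_ i)]] := exS _ _ j Se (Mf S SP) neq_ef (esym fj).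
  case=> [|_ e'i]; first exact/eqP.
  exists e'; split=> //; rewrite e'i ei; last by lia.
  by apply/minn_idPl; exact: ltnW.
suff [e [Se ei le_K _]] : exists e, [/\ S e, e i = a, K <= e j & e0 j <= e j].
  by exists e.
elim: K => [|K [e [Se ei le_K le_e]]]; first by exists e0; split=> //; apply: Me0.
have [e' [Se' e'i lt_e']] := above e Se ei le_e.
by exists e'; split=> //; [apply: leq_ltn_trans lt_e' | apply: leq_trans (ltnW lt_e')].
Qed.

(** Write [a = c + (a - c)] and add an element large at [j] to one large on [s]. *)
Lemma good_over_coords i (s : seq 'I_n) : i \notin s ->
  exists c, forall S, good_over eta S -> forall a K, c <= a ->
  exists e, [/\ S e, e i = a & forall j, j \in s -> K <= e j].
Proof.
elim: s => [_|j s IHs].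
  have [c cP] := good_over_coord i; exists c => S SP a K /(cP _ SP)[e Se ei].
  by exists e.
rewrite inE negb_or => /andP[/eqP/good_over_coord2[c cP] /IHs[d dP]].
exists (c + d) => S SP a K le_a; have [[[_ SD] _ _ _ _] _] := SP.
have [e [Se ei ej]] := cP S SP c K (leqnn c).
have [|f [Sf fi fs]] := dP S SP (a - c) K; first by lia.
exists (e + f)%R; split; first exact: SD.
  by rewrite natvecD ei fi; lia.
move=> l; rewrite inE natvecD => /orP[/eqP->|/fs le_l].
  exact: leq_trans (leq_addr _ _).
exact: leq_trans (leq_addl _ _).
Qed.

(** [a] is the minimum of elements [e i] of [S] that agree with [a] at [i] and dominate it
    elsewhere. *)
Lemma good_over_conductor : exists c, forall S, good_over eta S ->
  forall a : natvec n, (forall i, c <= a i) -> S a.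
Proof.
have /choice[c cP] i := good_over_coords i (rem i (enum 'I_n)) ltac:(
  by rewrite mem_rem_uniqF // enum_uniq).
exists (\max_i c i) => S SP a le_a.
have [[[S0 SD] Smin _ _ _] _] := SP.
set K := \max_i a i.
have /choice[e eP] i : exists e : natvec n, [/\ S e, e i = a i & forall j, a j <= e j].
  have le_i : c i <= a i by apply: leq_trans (le_a i); apply: leq_bigmax.
  have [e [Se ei le_e]] := cP i S SP (a i) K le_i.
  exists e; split=> // j; have [->|neq_ji] := eqVneq j i; first by rewrite ei.
  apply: (@leq_trans K); first exact: leq_bigmax.
  by apply: le_e; rewrite mem_rem_uniq ?enum_uniq // inE neq_ji mem_enum.
(* The minimum needs a starting element [e i0]; without coordinates, [a] is [0]. *)
have [i0|no_i] := pickP 'I_n; last first.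
  suff -> : a = 0%R by [].
  by apply/ffunP => i; have := no_i i.
move=> _.
have [b [Sb le_b bE]] : exists b, [/\ S b, forall j, a j <= b j &
    forall i, i \in enum 'I_n -> b i = a i].
  elim: (enum 'I_n) => [|i s [b [Sb le_b bE]]].
    by exists (e i0); have [? ? ?] := eP i0; split.
  have [Se ei le_e] := eP i; exists (min_vec b (e i)); split.
  - exact: Smin.
  - by move=> j; rewrite ffunE leq_min le_b le_e.
  - move=> l; rewrite inE ffunE => /orP[/eqP->|/bE->].
      by rewrite ei; apply/minn_idPr.
    exact/minn_idPl.
suff -> : a = b by [].
by apply/ffunP => i; rewrite bE // mem_enum.
Qed.

End CommonConductor.

(** * Determination of a good semigroup by its trace on a box *)

Section Truncation.
Context {n : nat} (S : set (natvec n)) (c : nat).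
Hypothesis Smin : min_closed S.
Hypothesis Sex : exchange S.
Hypothesis Sc : forall a : natvec n, (forall i, c <= a i) -> S a.

(** (G3) at [l] with a vector [b] equal to [a] at [l] and larger elsewhere. *)
Lemma conductor_raise (a : natvec n) l : S a -> c <= a l ->
  exists e, [/\ S e, a l < e l & forall i, i != l -> e i = a i].
Proof.
move=> Sa le_a.
pose b : natvec n := [ffun i => if i == l then a l else (maxn c (a i)).+1].
have Sb : S b by apply: Sc => i; rewrite ffunE; case: eqP => // _; lia.
(* Equality forces [l] to be the only coordinate; the conductor then gives [e] directly. *)
have [ab|neq_ab] := pselect (a = b).
  exists [ffun i => if i == l then (a l).+1 else a i]; split.
  - apply: Sc => i; rewrite ffunE; case: eqP => [_|/eqP neq_il]; first by lia.
    by rewrite ab ffunE (negPf neq_il); lia.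
  - by rewrite ffunE eqxx.
  - by move=> i /negPf neq_il; rewrite ffunE neq_il.
have abl : a l = b l by rewrite ffunE eqxx.
have [e [Se lt_e eE]] := Sex a b l Sa Sb neq_ab abl.
exists e; split=> // i neq_il.
have [_] := eE i neq_il; rewrite ffunE (negPf neq_il) => ->; lia.
Qed.

(** Raising may overshoot [t]; a minimum with a vector equal to [t] at [l] and large elsewhere cuts
    back. *)
Lemma conductor_update (a : natvec n) l t : S a -> c <= a l <= t ->
  S [ffun i => if i == l then t else a i].
Proof.
move=> Sa /andP[le_ca le_at].
have [e [Se le_e eE]] :
    exists e, [/\ S e, maxn t (a l) <= e l & forall i, i != l -> e i = a i].
  elim: t {le_at} => [|t [e [Se le_e eE]]].
    by exists a; split=> //; rewrite max0n.
  have [|e' [Se' lt_e' e'E]] := conductor_raise e l Se; first by lia.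
  by exists e'; split=> [//||i neq_il]; [lia | rewrite e'E ?eE].
pose b : natvec n := [ffun i => if i == l then t else maxn c (a i)].
have Sb : S b by apply: Sc => i; rewrite ffunE; case: eqP => _; lia.
suff -> : [ffun i => if i == l then t else a i] = min_vec e b by apply: Smin.
apply/ffunP => i; rewrite !ffunE; case: eqP => [->|/eqP neq_il]; first by lia.
by rewrite eE //; lia.
Qed.

(** Truncating is a minimum with the constant vector [c]; conversely, the coordinates above [c] are
    restored one by one. *)
Lemma conductor_truncate (a : natvec n) : S [ffun i => minn (a i) c] <-> S a.
Proof.
split=> [Sa|Sa]; last first.
  have -> : [ffun i => minn (a i) c] = min_vec a [ffun=> c].
    by apply/ffunP => i; rewrite !ffunE.
  by apply: Smin => //; apply: Sc => i; rewrite ffunE.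
suff Ss (s : seq 'I_n) : S [ffun i => if i \in s then a i else minn (a i) c].
  have -> // : a = [ffun i => if i \in enum 'I_n then a i else minn (a i) c].
  by apply/ffunP => i; rewrite ffunE mem_enum.
elim: s => [//|l s IHs].
have [ls|lNs] := boolP ((l \in s) || (a l <= c)).
  rewrite (_ : [ffun i => _] =
    [ffun i => if i \in s then a i else minn (a i) c]) //.
  apply/ffunP => i; rewrite !ffunE inE; case: eqP => // ->.
  by case: ifP ls => //= _ /minn_idPl.
move: lNs; rewrite negb_or -ltnNge => /andP[/negPf lNs lt_c].
rewrite (_ : [ffun i => _] = [ffun i => if i == l then a l else
    [ffun i => if i \in s then a i else minn (a i) c] i]); last first.
  by apply/ffunP => i; rewrite !ffunE inE; case: eqP => // ->.
by apply: conductor_update => //; rewrite ffunE lNs; lia.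
Qed.

End Truncation.

Theorem proposition13 (n k : nat) (eta : 'I_k -> natvec n)
  (eta_gcd : forall i : 'I_n, \big[gcdn/0]_(h < k) eta h i = 1)
  (eta_sep : forall i j : 'I_n, i <> j -> exists l : 'I_k, eta l i <> eta l j) :
  finite_set (minimal_good_semigroups (range eta)).
Proof.
have [->|/set0P[S0 [good_S0 eta_S0 _]]] :=
  eqVneq (minimal_good_semigroups (range eta)) set0.
  exact: finite_set0.
(* Locality of [S0] makes any [eta h] with a zero coordinate vanish. *)
have eta_local h i j : 0 < eta h i -> 0 < eta h j.
  rewrite !lt0n; apply: contra_neq => eta0; have [_ _ _ _ loc] := good_S0.
  by rewrite (loc (eta h)) ?ffunE //; [apply: eta_S0; exists h | exists j].
have [c cP] := good_over_conductor eta eta_gcd eta_sep eta_local.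
(* The values given to [inord] are at most [c], so its default never occurs. *)
pose of_trace (B : {set {ffun 'I_n -> 'I_c.+1}}) : set (natvec n) :=
  [set a | [ffun i => inord (minn (a i) c)] \in B].
apply: (@sub_finite_set _ _ (range of_trace)); last first.
  by apply: finite_image; apply: finite_finset.
move=> S [good_S eta_S _].
have [_ Smin _ Sex _] := good_S.
have Sc := cP S (conj good_S eta_S).
pose B := [set f : {ffun 'I_n -> 'I_c.+1} | `[< S [ffun i => f i : nat] >]]%SET.
suff traceE (a : natvec n) : of_trace B a <-> S a.
  by exists B => //; apply/seteqP; split=> a /traceE.
rewrite -(conductor_truncate S c Smin Sex Sc a) /of_trace /= inE.
have -> : [ffun i => [ffun i => inord (minn (a i) c) : 'I_c.+1] i : nat] =
    [ffun i => minn (a i) c] :> natvec n.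
  by apply/ffunP => i; rewrite !ffunE inordK // ltnS geq_minr.
by split=> /asboolP.
Qed.
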